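(* The following statements are equivalent: (i) $\mathcal{H}\cap(\{0_Z\}\times\mathbb{R})=\mathcal{N}\cap(\{0_Z\}\times\mathbb{R})$; (ii) for any $\alpha\in\mathbb{R}$, the following two assertions (a) and (b) are equivalent: (a) for all $w\in Q^*$ satisfying $-A^*w+c\in P^*$, we have $\langle b,w\rangle\le\alpha$; (b) there exists $x\in P$ such that $Ax-b\in Q$ and $\langle x,c\rangle\le\alpha$.
   Context: Setting: $(X,Y)$ and $(Z,W)$ are separated dual pairs of real vector spaces, i.e. there are bilinear forms on $X\times Y$ and on $Z\times W$, both denoted $\langle\cdot,\cdot\rangle$, such that $\langle x_0,y\rangle=0$ for all $y\in Y$ implies $x_0=0$, and $\langle x,y_0\rangle=0$ for all $x\in X$ implies $y_0=0$ (and likewise for $(Z,W)$). No topology is assumed. $A:X\to Z$ is a linear map with adjoint $A^*:W\to Y$, a linear map satisfying $\langle x,A^*w\rangle=\langle Ax,w\rangle$ for all $x\in X$, $w\in W$ (assumed to exist). $P\subset X$ and $Q\subset Z$ are convex cones (nonempty, and $\alpha u+\beta v$ is in the cone for all $\alpha,\beta\ge 0$ and $u,v$ in the cone); $b\in Z$, $c\in Y$. Dual cones: $P^*=\{y\in Y:\langle x,y\rangle\ge 0\ \forall x\in P\}$, $Q^*=\{w\in W:\langle q,w\rangle\ge 0\ \forall q\in Q\}$. Feasible sets: $F(\mathcal{P})=\{x\in P: Ax-b\in Q\}$ and $F(\mathcal{D})=\{w\in Q^*:-A^*w+c\in P^*\}$; both are assumed nonempty. Definitions: $\mathcal{H}=\bigcup_{x\in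 P}\big((Ax-b-Q)\times[\langle x,c\rangle,+\infty[\big)\subset Z\times\mathbb{R}$; $v_{\mathcal{D}}(z)=\sup\{\langle b+z,w\rangle:w\in F(\mathcal{D})\}$ for $z\in Z$ (possibly $+\infty$); $\mathcal{N}=\mathrm{epi}\,v_{\mathcal{D}}=\{(z,r)\in Z\times\mathbb{R}: v_{\mathcal{D}}(z)\le r\}$. $0_Z$ is the zero vector of $Z$. *)

(* Defs.v *)
From mathcomp Require Import all_boot all_order all_algebra.
From mathcomp Require Import all_classical all_reals ereal.

Set Implicit Arguments.
Unset Strict Implicit.
Unset Printing Implicit Defensive.

Import Order.TTheory GRing.Theory Num.Theory.

Local Open Scope classical_set_scope.
Local Open Scope ring_scope.

Definition separated_pairing (R : realType) (X Y : lmodType R)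
    (f : {bilinear X -> Y -> R | *%R & *%R}) : Prop :=
  (forall x0 : X, (forall y : Y, f x0 y = 0) -> x0 = 0) /\
  (forall y0 : Y, (forall x : X, f x y0 = 0) -> y0 = 0).

Definition convex_cone (R : realType) (V : lmodType R) (C : set V) : Prop :=
  C !=set0 /\
  forall (a b : R) (u v : V), 0 <= a -> 0 <= b -> C u -> C v ->
    C (a *: u + b *: v).

Definition dual_cone (R : realType) (X Y : lmodType R)
    (f : {bilinear X -> Y -> R | *%R & *%R}) (C : set X) : set Y :=
  [set y | forall x, C x -> 0 <= f x y].

Definition is_adjoint (R : realType) (X Y Z W : lmodType R)
    (pXY : {bilinear X -> Y -> R | *%R & *%R})
    (pZW : {bilinear Z -> W -> R | *%R & *%R})
    (A : {linear X -> Z}) (A' : {linear W -> Y}) : Prop :=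
  forall (x : X) (w : W), pXY x (A' w) = pZW (A x) w.

Definition primal_feasible (R : realType) (X Z : lmodType R)
    (A : {linear X -> Z}) (P : set X) (Q : set Z) (b : Z) : set X :=
  [set x | P x /\ Q (A x - b)].

Definition dual_feasible (R : realType) (X Y Z W : lmodType R)
    (pXY : {bilinear X -> Y -> R | *%R & *%R})
    (pZW : {bilinear Z -> W -> R | *%R & *%R})
    (A' : {linear W -> Y}) (P : set X) (Q : set Z) (c : Y) : set W :=
  [set w | dual_cone pZW Q w /\ dual_cone pXY P (- A' w + c)].

Definition calH (R : realType) (X Y Z : lmodType R)
    (pXY : {bilinear X -> Y -> R | *%R & *%R})
    (A : {linear X -> Z}) (P : set X) (Q : set Z) (b : Z) (c : Y) :
    set (Z * R) :=
  \bigcup_(x in P) ([set A x - b - q | q in Q] `*` `[pXY x c, +oo[%classic).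

Definition dual_value (R : realType) (X Y Z W : lmodType R)
    (pXY : {bilinear X -> Y -> R | *%R & *%R})
    (pZW : {bilinear Z -> W -> R | *%R & *%R})
    (A' : {linear W -> Y}) (P : set X) (Q : set Z) (b : Z) (c : Y) (z : Z) :
    \bar R :=
  ereal_sup [set (pZW (b + z) w)%:E | w in dual_feasible pXY pZW A' P Q c].

Definition epi (R : realType) (Z : Type) (v : Z -> \bar R) : set (Z * R) :=
  [set p | (v p.1 <= p.2%:E)%E].

Definition calN (R : realType) (X Y Z W : lmodType R)
    (pXY : {bilinear X -> Y -> R | *%R & *%R})
    (pZW : {bilinear Z -> W -> R | *%R & *%R})
    (A' : {linear W -> Y}) (P : set X) (Q : set Z) (b : Z) (c : Y) :
    set (Z * R) :=
  epi (dual_value pXY pZW A' P Q b c).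

(* Main.v *)
Require Import Defs.
From mathcomp Require Import all_boot all_order all_algebra.
From mathcomp Require Import all_classical all_reals ereal.

(** Both sides compare the same two conditions on a real number [alpha].
    The point [(0, alpha)] lies in [calH] exactly when some [x] in [P]
    satisfies [0 = A x - b - q] for a [q] in [Q], that is [A x - b] is in [Q],
    and has cost at most [alpha] ([calH0P]): this is (b).  It lies in [calN]
    exactly when the supremum of [pZW b] over the dual feasible set is at most
    [alpha] ([calN0P]), i.e. when [alpha] is an upper bound: this is (a).  The
    slices over the origin therefore coincide if and only if (a) and (b) are
    equivalent for every [alpha]. *)

Import Order.TTheory GRing.Theory Num.Theory.

Local Open Scope classical_set_scope.
Local Open Scope ring_scope.

Lemma calH0P (R : realType) (X Y Z : lmodType R)
    (pXY : {bilinear X -> Y -> R | *%R & *%R}) (A : {linear X -> Z})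
    (P : set X) (Q : set Z) (b : Z) (c : Y) (alpha : R) :
  calH pXY A P Q b c (0, alpha) <->
  exists x : X, [/\ P x, Q (A x - b) & pXY x c <= alpha].
Proof.
split=> [[x Px [/= [q Qq /eqP]]]|[x [Px Qx cx]]].
  rewrite subr_eq0 => /eqP Axb_q; rewrite in_itv /= andbT => cx.
  by exists x; split=> //; rewrite Axb_q.
exists x => //; split => /=; last by rewrite in_itv /= andbT.
by exists (A x - b) => //; rewrite subrr.
Qed.

(** Phrasing the supremum bound as an upper bound over the feasible set avoids
    any case distinction on whether the dual value is finite. *)
Lemma calN0P (R : realType) (X Y Z W : lmodType R)
    (pXY : {bilinear X -> Y -> R | *%R & *%R})
    (pZW : {bilinear Z -> W -> R | *%R & *%R})
    (A' : {linear W -> Y}) (P : set X) (Q : set Z) (b : Z) (c : Y)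
    (alpha : R) :
  calN pXY pZW A' P Q b c (0, alpha) <->
  forall w : W, dual_cone pZW Q w -> dual_cone pXY P (- A' w + c) ->
    pZW b w <= alpha.
Proof.
rewrite /calN /epi /dual_value /= addr0; split=> [le_sup w Qw Pw|ub].
  rewrite -lee_fin; apply: le_trans le_sup.
  by apply: ereal_sup_ubound; exists w.
by apply: ge_ereal_sup => _ [w [Qw Pw] <-]; rewrite lee_fin; exact: ub.
Qed.

Lemma slice0_eqP (R : realType) (Z : lmodType R) (H N : set (Z * R)) :
  H `&` ([set 0] `*` [set: R]) = N `&` ([set 0] `*` [set: R]) <->
  forall alpha : R, N (0, alpha) <-> H (0, alpha).
Proof.
split=> [eqHN alpha|eqHN].
  have slice (S : set (Z * R)) :
      (S `&` ([set 0] `*` [set: R])) (0, alpha) <-> S (0, alpha).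
    by split=> [[]|].
  by rewrite -(slice N) -(slice H) eqHN.
by apply/seteqP; split=> -[z r] [Szr [/= z0 _]]; subst z; split=> //;
  apply/eqHN.
Qed.

Theorem theorem4p2 (R : realType) (X Y Z W : lmodType R)
    (pXY : {bilinear X -> Y -> R | *%R & *%R})
    (pZW : {bilinear Z -> W -> R | *%R & *%R})
    (sepXY : separated_pairing pXY) (sepZW : separated_pairing pZW)
    (A : {linear X -> Z}) (A' : {linear W -> Y})
    (adjA : is_adjoint pXY pZW A A')
    (P : set X) (Q : set Z) (coneP : convex_cone P) (coneQ : convex_cone Q)
    (b : Z) (c : Y)
    (feasP : primal_feasible A P Q b !=set0)
    (feasD : dual_feasible pXY pZW A' P Q c !=set0) :
  calH pXY A P Q b c `&` ([set 0] `*` [set: R]) =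
    calN pXY pZW A' P Q b c `&` ([set 0] `*` [set: R])
  <->
  (forall alpha : R,
    (forall w : W, dual_cone pZW Q w -> dual_cone pXY P (- A' w + c) ->
       pZW b w <= alpha)
    <->
    (exists x : X, [/\ P x, Q (A x - b) & pXY x c <= alpha])).
Proof.
apply: iff_trans (slice0_eqP _ _ _ _) _.
by split=> equiv alpha; have := equiv alpha; rewrite calH0P calN0P.
Qed.
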